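(* Let $d$ be a positive integer, let $P\subset\mathbb{R}^d_{>0}$ be a finite candidate set, and let $k$ be an integer with $1\le k\le|P|$. Let $\bar p\in\mathbb{R}^d_{>0}$ be a fixed anchor satisfying $$g_{\bar p}(w)\ge g_p(w)\qquad\text{for all }p\in P\text{ and all }w\in\Delta_{d-1}.$$ Set $R_0:=R_2(\{\bar p\})$, and define $Q_{\bar p}(S):=R_0-R_2(S)$ for nonempty $S\subseteq P$ and $Q_{\bar p}(\emptyset)=0$. Let $G_k$ be any subset of cardinality $k$ obtained by the greedy algorithm that starts from the empty set and, at each of $k$ steps, adds a not yet selected point of $P$ maximizing the marginal increase of $Q_{\bar p}$. Let $S_k^\star\in\arg\min\{R_2(S):S\subseteq P,\ |S|=k\}$. Then $$R_0-R_2(G_k)\ \ge\ \Bigl(1-\frac1e\Bigr)\bigl(R_0-R_2(S_k^\star)\bigr).$$ Equivalently, if $R_0>R_2(S_k^\star)$, $$\frac{R_0-R_2(G_k)}{R_0-R_2(S_k^\star)}\ge 1-\frac1e .$$ In residual-gap form, $$R_2(G_k)-R_2(S_k^\star)\le\frac1e\bigl(R_0-R_2(S_k^\star)\bigr),$$ and equivalently $$R_2(G_k)\le\Bigl(1-\frac1e\Bigr)R_2(S_k^\star)+\frac1e R_0 .$$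
   Context: The ideal point is fixed and translated to the origin. Let $\Delta_{d-1}=\{w\in\mathbb{R}^d_{\ge 0}:w_1+\dots+w_d=1\}$. For $p\in\mathbb{R}^d_{>0}$ and $w\in\Delta_{d-1}$ let $g_p(w)=\max_{i=1,\dots,d}w_ip_i$. For a finite nonempty $S\subset\mathbb{R}^d_{>0}$ let $R_2(S)=\int_{\Delta_{d-1}}\min_{p\in S}g_p(w)\,\mathrm{d}w$, where $\mathrm{d}w$ denotes integration against a fixed weight distribution on $\Delta_{d-1}$, i.e. a fixed finite Borel measure (by default $(d-1)$-dimensional Lebesgue measure on the simplex). Ties in the greedy choice are broken arbitrarily. *)

(* Defs.v *)
From HB Require Import structures.
From mathcomp Require Import all_boot all_order all_algebra finmap.
From mathcomp Require Import all_classical all_reals all_analysis.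
Import Order.TTheory GRing.Theory Num.Theory.
Import numFieldNormedType.Exports.

Set Implicit Arguments.
Unset Strict Implicit.
Unset Printing Implicit Defensive.

Local Open Scope classical_set_scope.
Local Open Scope ring_scope.

Definition posvec (R : realType) (d : nat) : set 'rV[R]_d :=
  [set p | forall i : 'I_d, 0 < p ord0 i].

Definition simplex (R : realType) (d : nat) : set 'rV[R]_d :=
  [set w | (forall i : 'I_d, 0 <= w ord0 i) /\ \sum_(i < d) w ord0 i = 1].

(* R^d with its Borel sigma-algebra, generated by the open sets. *)
Definition borelRV (R : realType) (d : nat) :=
  g_sigma_algebraType (@open 'rV[R]_d).

(* The default value 0 of the big maximum is harmless: all the products are
   nonnegative when w is in the simplex and p has positive coordinates. *)
Definition gmax (R : realType) (d : nat) (p w : 'rV[R]_d) : R :=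
  \big[Num.max/0]_(i < d) (w ord0 i * p ord0 i).

(* The default value of the big minimum is the value at one of the elements of
   S, so this is the minimum over S whenever S is nonempty; for S empty it is
   a junk value. *)
Definition gmin (R : realType) (d : nat) (S : {fset 'rV[R]_d})
    (w : 'rV[R]_d) : R :=
  \big[Num.min/gmax (head 0 (enum_fset S)) w]_(p <- enum_fset S) gmax p w.

(* A finite Borel measure on the simplex is the same thing as the restriction
   to the simplex of a finite Borel measure mu on R^d; the mass of mu outside
   the simplex plays no role. *)
Definition R2 (R : realType) (d : nat)
    (mu : {finite_measure set (borelRV R d) -> \bar R})
    (S : {fset 'rV[R]_d}) : R :=
  Rintegral mu (@simplex R d) (gmin S).

Definition Qanchor (R : realType) (d : nat)
    (mu : {finite_measure set (borelRV R d) -> \bar R})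
    (pbar : 'rV[R]_d) (S : {fset 'rV[R]_d}) : R :=
  if S == fset0 then 0 else R2 mu [fset pbar]%fset - R2 mu S.

(* greedy Q P k G: some run of k greedy steps for Q on P, with ties broken
   arbitrarily, outputs the set G. *)
Inductive greedy (R : realType) (T : choiceType) (Q : {fset T} -> R)
    (P : {fset T}) : nat -> {fset T} -> Prop :=
| greedy0 : greedy Q P 0 fset0
| greedyS (k : nat) (G : {fset T}) (p : T) :
    greedy Q P k G -> p \in P -> p \notin G ->
    (forall q : T, q \in P -> q \notin G ->
       Q (q |` G)%fset - Q G <= Q (p |` G)%fset - Q G) ->
    greedy Q P k.+1 (p |` G)%fset.

Definition R2_optimal (R : realType) (d : nat)
    (mu : {finite_measure set (borelRV R d) -> \bar R})
    (P : {fset 'rV[R]_d}) (k : nat) (S : {fset 'rV[R]_d}) : Prop :=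
  [/\ (S `<=` P)%fset, #|` S|%fset = k &
      forall S' : {fset 'rV[R]_d},
        (S' `<=` P)%fset -> #|` S'|%fset = k -> R2 mu S <= R2 mu S'].

(* Main.v *)
(** For each weight w, adjoining the anchor to S does not change the minimum of
    the g_p(w) over a nonempty S, and makes it meaningful for S empty.  This
    lower envelope decreases in S with diminishing decrements, and both
    properties survive integration, so the quality Q is monotone and
    submodular with Q(∅) = 0.  If p is the greedy choice at G, submodularity
    gives Q(S) - Q(G) <= k (Q(G + p) - Q(G)) for |S| = k: each step shrinks the
    gap to Q(S) by a factor 1 - 1/k, and (1 - 1/k)^k <= 1/e. *)
Require Import Defs.
From HB Require Import structures.
From mathcomp Require Import all_boot all_order all_algebra finmap.
From mathcomp Require Import all_classical all_reals all_analysis.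
From mathcomp Require Import measurable_realfun ring lra.
Import Order.TTheory GRing.Theory Num.Theory.
Import numFieldNormedType.Exports.

Set Implicit Arguments.
Unset Strict Implicit.
Unset Printing Implicit Defensive.

Local Open Scope classical_set_scope.
Local Open Scope ring_scope.

(** * Greedy selection for an abstract set function *)

Lemma greedy_subset (R : realType) (T : choiceType) (Q : {fset T} -> R)
    (P : {fset T}) (m : nat) (G : {fset T}) :
  greedy Q P m G -> (G `<=` P)%fset.
Proof.
elim=> [|k H p _ HP pP _ _]; first exact: fsub0set.
by rewrite fsubUset fsub1set pP.
Qed.

Lemma greedy_geometric_gap (R : realType) (T : choiceType)
    (Q : {fset T} -> R) (P S : {fset T}) (m : nat) (G : {fset T}) :
  (forall (G' : {fset T}) p, (G' `<=` P)%fset -> p \in P ->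
     Q G' <= Q (p |` G')%fset) ->
  (forall G' : {fset T}, (G' `<=` P)%fset ->
     Q S - Q G' <= \sum_(p <- enum_fset S) (Q (p |` G')%fset - Q G')) ->
  (S `<=` P)%fset -> (0 < #|` S|)%N -> greedy Q P m G ->
  Q S - Q G <= (1 - #|` S|%:R^-1) ^+ m * (Q S - Q fset0).
Proof.
move=> Qmono Qsub SP S0; elim=> [|k H p Hgreedy IH pP pH pmax].
  by rewrite expr0 mul1r.
have HP := greedy_subset Hgreedy.
set n : R := #|` S|%:R.
have n0 : 0 < n by rewrite ltr0n.
have le_gain q : q \in S -> Q (q |` H)%fset - Q H <= Q (p |` H)%fset - Q H.
  (* Greedy maximality compares only unselected points; a point of [S] already in [H] has gain 0, at
     most the greedy gain by monotonicity. *)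
  move=> /(fsubsetP SP) qP; have [qH|] := boolP (q \in H); last exact: pmax.
  have -> : (q |` H = H)%fset by apply/fsetUidPr; rewrite fsub1set.
  by rewrite lerD2r; exact: Qmono.
have gap_le : Q S - Q H <= n * (Q (p |` H)%fset - Q H).
  apply: (le_trans (Qsub _ HP)).
  rewrite /n mulr_natl big_seq (le_trans (ler_sum _ le_gain))// -big_seq.
  by rewrite big_const_seq count_predT iter_addr_0.
have step : Q S - Q (p |` H)%fset <= (1 - n^-1) * (Q S - Q H).
  have : n^-1 * (Q S - Q H) <= Q (p |` H)%fset - Q H.
    by rewrite mulrC ler_pdivrMr// mulrC.
  by rewrite mulrBl mul1r -addrA lerD2l -opprD lerN2 -lerBrDl.
(* Multiplying the induction hypothesis by [1 - n^-1] keeps its direction because [n >= 1]. *)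
apply: (le_trans step); rewrite exprS -mulrA ler_wpM2l//.
by rewrite subr_ge0 invf_le1// ler1n.
Qed.

(** Take 1 + x <= exp x at x = -1/n and raise it to the n-th power, both sides being nonnegative. *)
Lemma exp_onem_inv_le (R : realType) (n : nat) : (0 < n)%N ->
  (1 - n%:R^-1) ^+ n <= (expR 1)^-1 :> R.
Proof.
move=> n0; have n0R : (n%:R : R) != 0 by rewrite pnatr_eq0 -lt0n.
have -> : (expR 1)^-1 = expR (- n%:R^-1) ^+ n :> R.
  by rewrite -expRM_natl mulrN mulfV// expRN.
apply: lerXn2r; rewrite ?nnegrE ?expR_ge0//.
  by rewrite subr_ge0 invf_le1 ?ltr0n// ler1n.
exact: expR_ge1Dx.
Qed.

(** * Pointwise theory of the lower envelope *)

Section envelope.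
Variables (R : realType) (d : nat) (pbar : 'rV[R]_d).
Implicit Types (S G : {fset 'rV[R]_d}) (p w : 'rV[R]_d).

(* Unlike [gmin], this minimum always includes the anchor, so it is the right
   function for the empty set too, where [Qanchor] is defined to vanish. *)
Definition envelope S w : R :=
  \big[Num.min/gmax pbar w]_(p <- enum_fset S) gmax p w.

Lemma gmax_ge0 p w : 0 <= gmax p w.
Proof. exact: bigmax_ge_id. Qed.

Lemma envelope_ge0 S w : 0 <= envelope S w.
Proof. by apply: le_bigmin => *; exact: gmax_ge0. Qed.

Lemma envelope_le_anchor S w : envelope S w <= gmax pbar w.
Proof. exact: bigmin_le_id. Qed.

Lemma envelope_le S p w : p \in S -> envelope S w <= gmax p w.
Proof. by move=> pS; exact: ge_bigmin_seq. Qed.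

Lemma le_envelope S G w : (G `<=` S)%fset -> envelope S w <= envelope G w.
Proof. by move=> /fsubsetP GS; exact: sub_bigmin_seq. Qed.

(** The two minima differ only in their defaults: the anchor's value, which no member of [S]
    exceeds, and the value at the head of [S], itself a member. *)
Lemma envelope_eq_gmin S w : S != fset0 ->
  (forall p, p \in S -> gmax p w <= gmax pbar w) ->
  envelope S w = gmin S w.
Proof.
move=> S0 Sanchor.
have hS : head 0 (enum_fset S) \in S.
  by rewrite -nth0; apply: mem_nth; rewrite cardfs_gt0.
apply/eqP; rewrite eq_le; apply/andP; split.
  rewrite /gmin big_seq; apply: le_bigmin => [|p pS]; exact: envelope_le.
rewrite /envelope big_seq; apply: le_bigmin => [|p pS].
  exact: le_trans (bigmin_le_id _ _ _ _) (Sanchor _ hS).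
exact: ge_bigmin_seq.
Qed.

(* If the minimum defining [envelope S w] is attained at q in S, the single
   term of index q on the right already dominates the left-hand side. *)
Lemma envelope_submodular S G w :
  envelope G w - envelope S w <=
  \sum_(p <- enum_fset S) (envelope G w - envelope (p |` G)%fset w).
Proof.
have ge0 p : 0 <= envelope G w - envelope (p |` G)%fset w.
  by rewrite subr_ge0; apply: le_envelope; exact: fsubsetUr.
(* With [envelope S w] alone on the right, it suffices to bound each entry of its minimum: the
   anchor's value and each [gmax q w]. *)
rewrite lerBlDl -lerBlDr [leRHS]big_seq.
apply: le_bigmin => [|q qS]; rewrite lerBlDr.
  by rewrite (le_trans (envelope_le_anchor _ _))// lerDl sumr_ge0.
rewrite (big_fsetD1 q)//= addrA -[leLHS]addr0; apply: lerD; last exact: sumr_ge0.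
by rewrite addrCA lerDl subr_ge0; apply: envelope_le; exact: fset1U1.
Qed.
End envelope.

Lemma gmin_fset1 (R : realType) (d : nat) (p w : 'rV[R]_d) :
  gmin [fset p]%fset w = gmax p w.
Proof.
rewrite -(@envelope_eq_gmin _ _ p); last by move=> q /fset1P ->.
  by rewrite /envelope big_seq bigmin_eq_id// => q /fset1P ->.
by apply/fset0Pn; exists p; exact: fset11.
Qed.

(** * Measurability and integrability on the simplex *)

Section integration.
Variables (R : realType) (d : nat).
Local Notation borelRV := (borelRV R d).

Lemma measurable_coord (D : set borelRV) (i : 'I_d) :
  measurable_fun D (fun w : borelRV => (w : 'rV[R]_d) ord0 i).
Proof.
apply: (@measurable_funS _ _ _ _ setT) => //.
(* Open intervals generate the Borel sets of the line, and their preimages under a continuous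
   coordinate are open. *)
apply: (measurability _ (RGenOpens.measurableE R)) => _ [_ [a [b ->]] <-].
rewrite setTI; apply: sub_sigma_algebra.
apply: open_comp => [x _|]; first exact: coord_continuous.
exact: interval_open.
Qed.

Lemma measurable_simplex : measurable (@simplex R d : set borelRV).
Proof.
have -> : @simplex R d =
    (\bigcap_(i in [set: 'I_d]) ((fun w : borelRV => (w : 'rV[R]_d) ord0 i)
       @^-1` `[0, +oo[%classic)) `&`
    ((fun w : borelRV => \sum_(i < d) (w : 'rV[R]_d) ord0 i) @^-1` [set 1]).
  apply/seteqP; split => w /= [w0 w1]; split=> // i.
    by rewrite /= in_itv/= andbT.
  by have := w0 i I; rewrite /= in_itv/= andbT.
apply: measurableI.
  apply: fin_bigcap_measurable => [|i _]; first exact: finite_finset.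
  by rewrite -[X in measurable X]setTI; exact: measurable_coord.
rewrite -[X in measurable X]setTI; apply: measurable_sum => // i.
exact: measurable_coord.
Qed.

Lemma measurable_bigmaxr (disp : measure_display) (T : measurableType disp)
    (D : set T) (I : Type) (s : seq I) (f0 : T -> R) (f : I -> T -> R) :
  measurable_fun D f0 -> (forall i, measurable_fun D (f i)) ->
  measurable_fun D (fun x => \big[Num.max/f0 x]_(i <- s) f i x).
Proof.
move=> mf0 mf; elim: s => [|i s IH]; first by under eq_fun do rewrite big_nil.
by under eq_fun do rewrite big_cons; exact: measurable_maxr.
Qed.

(** The default [f0] varies with the point, as the anchor's value does in [envelope]. *)
Lemma measurable_bigminr (disp : measure_display) (T : measurableType disp)
    (D : set T) (I : Type) (s : seq I) (f0 : T -> R) (f : I -> T -> R) :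
  measurable_fun D f0 -> (forall i, measurable_fun D (f i)) ->
  measurable_fun D (fun x => \big[Num.min/f0 x]_(i <- s) f i x).
Proof.
move=> mf0 mf; elim: s => [|i s IH]; first by under eq_fun do rewrite big_nil.
by under eq_fun do rewrite big_cons; exact: measurable_minr.
Qed.

Lemma measurable_gmax (D : set borelRV) (p : 'rV[R]_d) :
  measurable_fun D (gmax p : borelRV -> R).
Proof.
apply: measurable_bigmaxr => // i.
by apply: measurable_funM => //; exact: measurable_coord.
Qed.

(** A bounded measurable function on a set of finite measure: coordinates of a simplex point are at
    most 1, so the largest coordinate of [pbar] is a bound. *)
Lemma integrable_envelope (mu : {finite_measure set borelRV -> \bar R})
    (pbar : 'rV[R]_d) (S : {fset 'rV[R]_d}) : posvec pbar ->
  mu.-integrable (@simplex R d) (EFin \o (envelope pbar S : borelRV -> R)).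
Proof.
move=> pbar0; apply: measurable_bounded_integrable.
- exact: measurable_simplex.
- by rewrite ltey_eq fin_num_measure//; exact: measurable_simplex.
- by apply: measurable_bigminr => [|p]; exact: measurable_gmax.
exists (\big[Num.max/0]_(i < d) pbar ord0 i); split; first exact: num_real.
move=> M /ltW leM w /= [w0 w1].
rewrite ger0_norm ?envelope_ge0//.
apply: le_trans leM; apply: (le_trans (envelope_le_anchor _ _ _)).
apply: le_bigmax2 => i _; rewrite ler_piMl ?(ltW (pbar0 i))//.
by rewrite -w1 (bigD1 i)//= lerDl sumr_ge0.
Qed.

End integration.

Lemma Rintegral_sum (disp : measure_display) (T : measurableType disp)
    (R : realType) (mu : {measure set T -> \bar R}) (D : set T)
    (I : Type) (s : seq I) (f : I -> T -> R) :
  measurable D -> (forall i, mu.-integrable D (EFin \o f i)) ->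
  Rintegral mu D (fun x => \sum_(i <- s) f i x) =
  \sum_(i <- s) Rintegral mu D (f i).
Proof.
move=> mD intf; elim: s => [|i s IH].
  rewrite big_nil; under eq_Rintegral do rewrite big_nil.
  by rewrite Rintegral_cst// mul0r.
rewrite big_cons -IH -RintegralD//.
  by apply: eq_Rintegral => x _; rewrite big_cons.
have := integrable_sum mD s (P := xpredT) (fun j _ => intf j).
by apply: eq_integrable => // x _; rewrite /= sumEFin.
Qed.

(** * Monotonicity and submodularity of the quality *)

Section anchored_quality.
Variables (R : realType) (d : nat).
Variable mu : {finite_measure set (borelRV R d) -> \bar R}.
Variables (P : {fset 'rV[R]_d}) (pbar : 'rV[R]_d).
Hypothesis pbar_pos : posvec pbar.
Hypothesis anchor : forall p w : 'rV[R]_d, p \in P -> simplex w ->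
  gmax p w <= gmax pbar w.
Implicit Types (S G : {fset 'rV[R]_d}) (p : 'rV[R]_d).

Let intE S := integrable_envelope mu S pbar_pos.
Let mS := @measurable_simplex R d.
Let J S : R := Rintegral mu (@simplex R d) (envelope pbar S).

(** This removes the case split in [Qanchor]: at the empty set the envelope is the anchor's own
    function, so the difference vanishes. *)
Lemma Qanchor_envelope S : (S `<=` P)%fset ->
  Qanchor mu pbar S = R2 mu [fset pbar]%fset - J S.
Proof.
move=> /fsubsetP SP; rewrite /Qanchor; case: eqP => [->|/eqP S0].
  apply/esym/eqP; rewrite subr_eq0 /R2 /J; apply/eqP/eq_Rintegral => w _.
  transitivity (gmax pbar w); first exact: gmin_fset1.
  by rewrite /envelope big_nil.
rewrite /R2 /J; congr (_ - _); apply: eq_Rintegral => w /set_mem sw.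
by apply: esym; apply: envelope_eq_gmin => // p /SP pP; exact: anchor.
Qed.

Lemma Qanchor_monotone S G : (S `<=` G)%fset -> (G `<=` P)%fset ->
  Qanchor mu pbar S <= Qanchor mu pbar G.
Proof.
move=> SG GP; rewrite !Qanchor_envelope//; last exact: fsubset_trans GP.
rewrite lerD2l lerN2; apply: (le_Rintegral mS (intE G) (intE S)) => w _.
exact: le_envelope.
Qed.

Lemma Qanchor_submodular S G : (S `<=` P)%fset -> (G `<=` P)%fset ->
  Qanchor mu pbar S - Qanchor mu pbar G <=
  \sum_(p <- enum_fset S) (Qanchor mu pbar (p |` G)%fset - Qanchor mu pbar G).
Proof.
move=> SP GP.
(* The constant cancels, so a quality gain is the integral of a drop of the envelope. *)
have subJ A B : R2 mu [fset pbar]%fset - J A - (R2 mu [fset pbar]%fset - J B) =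
    Rintegral mu (@simplex R d)
      (fun w => envelope pbar B w - envelope pbar A w).
  by rewrite (RintegralB mS (intE B) (intE A)) opprB addrC addrA subrK.
have intB A B : mu.-integrable (@simplex R d)
    (EFin \o (fun w => envelope pbar B w - envelope pbar A w)).
  by have := integrableB mS (intE B) (intE A).
(* [big_seq] records that [p] lies in [S], so that adjoining it to [G] stays inside [P], where the
   anchor dominates. *)
rewrite !Qanchor_envelope// subJ big_seq.
under eq_bigr => p pS.
  rewrite Qanchor_envelope; last by rewrite fsubUset fsub1set GP (fsubsetP SP).
  rewrite subJ; over.
rewrite -big_seq -(Rintegral_sum _ mS (fun p => intB (p |` G)%fset G)).
apply: (le_Rintegral mS (intB S G)).
  have := integrable_sum mS (enum_fset S) (P := xpredT) (fun p _ => intB (p |` G)%fset G).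
  by apply: eq_integrable => // x _; rewrite /= sumEFin.
by move=> w _; exact: envelope_submodular.
Qed.

End anchored_quality.

Theorem theorem4p5 (R : realType) (d : nat) (hd : (0 < d)%N)
    (mu : {finite_measure set (borelRV R d) -> \bar R})
    (P : {fset 'rV[R]_d}) (hP : forall p, p \in P -> posvec p)
    (k : nat) (hk : (1 <= k <= #|` P|)%N)
    (pbar : 'rV[R]_d) (hpbar : posvec pbar)
    (hanchor : forall p w : 'rV[R]_d, p \in P -> simplex w ->
       gmax p w <= gmax pbar w)
    (Gk : {fset 'rV[R]_d}) (hGk : greedy (Qanchor mu pbar) P k Gk)
    (Sk : {fset 'rV[R]_d}) (hSk : R2_optimal mu P k Sk) :
  let R0 := R2 mu [fset pbar]%fset in
  let e : R := expR 1 in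
  [/\ R0 - R2 mu Gk >= (1 - 1 / e) * (R0 - R2 mu Sk),
      R0 > R2 mu Sk -> (R0 - R2 mu Gk) / (R0 - R2 mu Sk) >= 1 - 1 / e,
      R2 mu Gk - R2 mu Sk <= 1 / e * (R0 - R2 mu Sk) &
      R2 mu Gk <= (1 - 1 / e) * R2 mu Sk + 1 / e * R0].
Proof.
move=> R0 e; have [SkP Skk _] := hSk.
case/andP: hk => k0 _.
(* Since [k >= 1], both [Sk] and [Gk] are nonempty and [Qanchor] takes its integral branch on
   them. *)
have Sk0 : (0 < #|` Sk|)%N by rewrite Skk.
have Sk_neq0 : Sk != fset0 by rewrite -cardfs_gt0.
have Gk_neq0 : Gk != fset0.
  by case: hGk k0 => // m H p _ _ _ _ _; apply/fset0Pn; exists p; exact: fset1U1.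
have Q0 : Qanchor mu pbar fset0 = 0 by rewrite /Qanchor eqxx.
have QSk : Qanchor mu pbar Sk = R0 - R2 mu Sk by rewrite /Qanchor (negbTE Sk_neq0).
have QGk : Qanchor mu pbar Gk = R0 - R2 mu Gk by rewrite /Qanchor (negbTE Gk_neq0).
(* This sign lets the bound on (1 - 1/k)^k be multiplied by the optimal gain. *)
have gain_ge0 : 0 <= R0 - R2 mu Sk.
  rewrite -QSk; have := Qanchor_monotone mu hpbar hanchor (fsub0set Sk) SkP.
  by rewrite Q0.
have gap : R2 mu Gk - R2 mu Sk <= 1 / e * (R0 - R2 mu Sk).
  (* The number of greedy steps and the size of [Sk] are both [k], so the contraction factor is (1 -
     1/k)^k. *)
  have := greedy_geometric_gap _ _ SkP Sk0 hGk.
  rewrite Q0 subr0 QSk QGk Skk => H.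
  have -> : R2 mu Gk - R2 mu Sk = R0 - R2 mu Sk - (R0 - R2 mu Gk).
    by ring.
  apply: (le_trans (H _ _)).
  - move=> G' p G'P pP; apply: (Qanchor_monotone mu hpbar hanchor).
      exact: fsubsetUr.
    by rewrite fsubUset fsub1set pP.
  - by move=> G' G'P; rewrite -QSk; exact: (Qanchor_submodular mu hpbar hanchor SkP G'P).
  - by rewrite div1r ler_wpM2r//; exact: exp_onem_inv_le.
have main : (1 - 1 / e) * (R0 - R2 mu Sk) <= R0 - R2 mu Gk by lra.
split=> //.
- by move=> gt0; rewrite ler_pdivlMr// subr_gt0.
- by lra.
Qed.
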